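(* Let $G=(V,E)$ be a weighted graph and let $\Omega\subset V$ be a finite nonempty subset with $\delta\Omega$ finite and nonempty and $\widetilde{\Omega}$ connected. Then the $\ell^2$-$\ell^2$ and $\ell^\infty$-$\ell^\infty$ norms of the Dirichlet-to-Neumann operator $\Lambda$ on $\Omega$ satisfy $$\|\Lambda\|_{2,2}\leq 1,\qquad \|\Lambda\|_{\infty,\infty}\leq 2.$$
   Context: $V$ is a countable set and $\mu:V\times V\to[0,\infty)$, $(x,y)\mapsto\mu_{xy}=\mu_{yx}$, is a symmetric weight function; $\{x,y\}\in E$ (written $x\sim y$) iff $\mu_{xy}>0$. Self-loops are allowed. For $\Omega_1,\Omega_2\subset V$, $E(\Omega_1,\Omega_2)=\{\{x,y\}\in E: x\in\Omega_1,y\in\Omega_2\}$. The vertex boundary is $\delta\Omega=\{x\in V\setminus\Omega: x\sim y\text{ for some }y\in\Omega\}$, and $\overline{\Omega}=\Omega\cup\delta\Omega$. The graph $\widetilde{\Omega}$ has vertex set $\overline{\Omega}$ and edge set $E(\Omega,\overline{\Omega})$. The measure $m:\overline{\Omega}\to(0,\infty)$ is $m_x=\sum_{y\in V,\,y\sim x}\mu_{xy}$ for $x\in\Omega$ and $m_x=\sum_{y\in\Omega,\,y\sim x}\mu_{xy}$ for $x\in\delta\Omega$. For $f:\overline{\Omega}\to\mathbb{R}$: $\Delta f(x)=\frac1{m_x}\sum_{y\sim x}\mu_{xy}(f(y)-f(x))$ for $x\in\Omega$, and $\frac{\partial f}{\partial n}(z)=\frac1{m_z}\sum_{x\in\Omega,\,x\sim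 z}\mu_{zx}(f(z)-f(x))$ for $z\in\delta\Omega$. For $\varphi:\delta\Omega\to\mathbb{R}$, $u_\varphi:\overline{\Omega}\to\mathbb{R}$ is the unique function with $\Delta u_\varphi=0$ on $\Omega$ and $u_\varphi=\varphi$ on $\delta\Omega$. The Dirichlet-to-Neumann operator is $\Lambda:\mathbb{R}^{\delta\Omega}\to\mathbb{R}^{\delta\Omega}$, $\Lambda\varphi=\frac{\partial u_\varphi}{\partial n}$. For $\varphi:\delta\Omega\to\mathbb{R}$, $\|\varphi\|_{\ell^p}=\left(\sum_{x\in\delta\Omega}|\varphi(x)|^pm_x\right)^{1/p}$ for $p\in[1,\infty)$ and $\|\varphi\|_{\ell^\infty}=\sup_{x\in\delta\Omega}|\varphi(x)|$. The operator norm is $\|\Lambda\|_{p,p}=\sup\{\|\Lambda\varphi\|_{\ell^p}:\varphi\in\mathbb{R}^{\delta\Omega},\ \|\varphi\|_{\ell^p}=1\}$. *)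

(* Defs.v *)
From HB Require Import structures.
From mathcomp Require Import all_boot all_order all_algebra.
From mathcomp Require Import all_classical all_reals all_analysis.
Set Implicit Arguments.
Unset Strict Implicit.
Unset Printing Implicit Defensive.
Import Order.TTheory GRing.Theory Num.Theory.
Local Open Scope classical_set_scope.
Local Open Scope ring_scope.

(* A set [A : set V] used as a type is the subtype of its elements, so that
   functions on a vertex set carry no values outside of it. The sums
   [\sum_(x \in A) F x] below have finite support as soon as Omega and its
   vertex boundary are finite. *)

Section DirichletToNeumann.
Context {R : realType} {V : countType}.
Variables (mu : V -> V -> R) (Omega : set V).

Definition adj (x y : V) : bool := 0 < mu x y.

Definition vboundary : set V :=
  [set x | ~ Omega x /\ exists2 y, Omega y & adj x y].

Definition vclosure : set V := Omega `|` vboundary.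

Definition from_interior : Omega -> vclosure := subfun (@subsetUl _ _ _).

Definition from_boundary : vboundary -> vclosure := subfun (@subsetUr _ _ _).

(* Adjacency in the graph on [vclosure] with edge set E(Omega, vclosure):
   edges between two boundary vertices are dropped. *)
Definition adj_tilde : rel vclosure := fun x y =>
  adj (val x) (val y) && ((val x \in Omega) || (val y \in Omega)).

Definition connected_tilde : Prop :=
  forall x y : vclosure, exists2 p : seq vclosure,
    path adj_tilde x p & last x p = y.

Definition vmeasure (x : vclosure) : R :=
  if val x \in Omega then \sum_(y \in [set y : V | adj (val x) y]) mu (val x) y
  else \sum_(y \in [set y : V | Omega y /\ adj (val x) y]) mu (val x) y.

(* A neighbour of a vertex of Omega always lies in [vclosure], so the sum runs
   over all the neighbours of x in the whole graph. *)
Definition laplacian (f : vclosure -> R) (x : Omega) : R :=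
  (vmeasure (from_interior x))^-1 *
  \sum_(y \in [set y : vclosure | adj (val x) (val y)])
    mu (val x) (val y) * (f y - f (from_interior x)).

Definition normal_derivative (f : vclosure -> R) (z : vboundary) : R :=
  (vmeasure (from_boundary z))^-1 *
  \sum_(x \in [set x : Omega | adj (val x) (val z)])
    mu (val z) (val x) * (f (from_boundary z) - f (from_interior x)).

Definition dirichlet_solution (phi : vboundary -> R) : set (vclosure -> R) :=
  [set u | (forall x : Omega, laplacian u x = 0) /\
           (forall z : vboundary, u (from_boundary z) = phi z)].

(* [xget] picks an element of the set of solutions, which is a singleton by
   [dirichlet_wellposed] below; the default value 0 is then irrelevant. *)
Definition harmonic_extension (phi : vboundary -> R) : vclosure -> R :=
  xget (fun=> 0) (dirichlet_solution phi).

Definition dtn (phi : vboundary -> R) : vboundary -> R :=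
  normal_derivative (harmonic_extension phi).

(* Meant for p in [1, +oo]. *)
Definition lp_norm (p : \bar R) (phi : vboundary -> R) : R :=
  match p with
  | p%:E => (\sum_(x \in [set: vboundary])
               `|phi x| `^ p * vmeasure (from_boundary x)) `^ p^-1
  | +oo%E => sup [set `|phi x| | x in [set: vboundary]]
  | -oo%E => 0
  end.

(* The supremum is taken in the extended reals: the real-valued [sup] of an
   unbounded set is 0. *)
Definition operator_norm (p : \bar R)
    (T : (vboundary -> R) -> vboundary -> R) : \bar R :=
  ereal_sup [set (lp_norm p (T phi))%:E | phi in [set phi | lp_norm p phi = 1]].

End DirichletToNeumann.

Arguments dtn {R V} mu Omega phi.
Section Wellposedness.
Context {R : realType} {V : countType}.
Variables (mu : V -> V -> R) (Omega : set V).
Hypothesis mu_ge0 : forall x y, 0 <= mu x y.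
Hypothesis mu_sym : forall x y, mu x y = mu y x.
Hypothesis Omega_fin : finite_set Omega.
Hypothesis boundary_fin : finite_set (vboundary mu Omega).
Hypothesis boundary_neq0 : vboundary mu Omega !=set0.
Hypothesis tilde_connected : connected_tilde mu Omega.

Local Notation T := (vclosure mu Omega).
Local Notation inO := (@from_interior R V mu Omega).
Local Notation inB := (@from_boundary R V mu Omega).

Lemma vclosure_finite (A : set T) : finite_set A.
Proof.
apply: (@sub_finite_set _ _ [set: T]) => //.
rewrite (eq_finite_set (card_setT (vclosure mu Omega))).
by rewrite /vclosure finite_setU.
Qed.

Lemma adjC (x y : V) : adj mu x y = adj mu y x.
Proof. by rewrite /adj mu_sym. Qed.

Lemma adj_vclosure (x : Omega) (y : V) :
  adj mu (val x) y -> vclosure mu Omega y.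
Proof.
move=> xy; have [Oy|Oy] := pselect (Omega y); first by left.
right; by split=> //; exists (val x); [exact: set_valP|rewrite adjC].
Qed.

Lemma vclosure_cases (x : T) :
  (exists o : Omega, inO o = x) \/ (exists z, inB z = x).
Proof.
have [Ox|Bx] := set_valP x.
  left; by exists (SigSub (mem_set Ox)); exact: val_inj.
right; by exists (SigSub (mem_set Bx)); exact: val_inj.
Qed.

Lemma vmeasure_interior_gt0 (x : Omega) (y : V) :
  adj mu (val x) y -> 0 < vmeasure (inO x).
Proof.
move=> xy; rewrite /vmeasure mem_set /=; last exact: set_valP.
rewrite (fsbigD1 y) //=; last first.
  apply: (@sub_finite_set _ _ (vclosure mu Omega)).
    by move=> z; exact: adj_vclosure.
  by rewrite /vclosure finite_setU.
by rewrite ltr_wpDr// fsumr_ge0.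
Qed.

Lemma harmonic_max (f : T -> R) (x : Omega) (y : T) :
  laplacian f x = 0 -> (forall z, f z <= f (inO x)) ->
  adj mu (val x) (val y) -> f y = f (inO x).
Proof.
move=> Lf fmax xy; have m0 := vmeasure_interior_gt0 xy.
move/eqP: Lf; rewrite /laplacian mulf_eq0 invr_eq0 (gt_eqF m0) /= => /eqP.
rewrite (fsbigD1 y) //=; last exact: vclosure_finite.
set S := (X in _ + X = _) => S0.
have S_le0 : S <= 0.
  by apply: fsumr_le0 => z _; rewrite mulr_ge0_le0// subr_le0.
have t0 : mu (val x) (val y) * (f y - f (inO x)) = 0.
  apply/eqP; rewrite eq_le mulr_ge0_le0 ?subr_le0//=.
  by rewrite -(lerD2r S) S0 add0r.
move/eqP: t0; rewrite mulf_eq0 subr_eq0 gt_eqF//= => /eqP //.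
Qed.

Lemma max_principle (f : T -> R) : (forall x, laplacian f x = 0) ->
  (forall z, f (inB z) <= 0) -> forall x, f x <= 0.
Proof.
move=> Lf fB x.
have [s sE] := (finite_seqP _).1 (vclosure_finite [set: T]).
have ins (y : T) : y \in s.
  by have : [set: T] y by []; rewrite sE.
pose i0 : seq_sub s := SeqSub (ins x).
case: (@arg_maxP _ _ _ i0 xpredT (fun i => f (ssval i)) isT) => i _ imax.
have fmax y : f y <= f (ssval i) by exact: (imax (SeqSub (ins y)) isT).
apply: le_trans (fmax x) _.
have [b Bb] := boundary_neq0.
pose z : vboundary mu Omega := SigSub (mem_set Bb).
have [p] := tilde_connected (ssval i) (inB z).
elim: p (ssval i) fmax => [|y p IH] w fmax /=.
  by move=> _ ->.
move=> /andP[/andP[wy _] yp] lst.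
have [[t xw]|[b' <-]] := vclosure_cases w; last exact: fB.
have fy : f y = f w.
  by move: wy fmax; rewrite -xw => wy fmax; exact: harmonic_max.
by rewrite -fy; apply: IH => // u; rewrite fy.
Qed.

Lemma laplacianD (a : R) (f g : T -> R) (x : Omega) :
  laplacian (fun y => a * f y + g y) x = a * laplacian f x + laplacian g x.
Proof.
rewrite /laplacian mulrCA -mulrDr; congr (_ * _).
rewrite mulr_fsumr -fsbig_split; last exact: vclosure_finite.
by apply: eq_fsbigr => y _ /=; rewrite opprD addrACA -mulrBr mulrDr mulrCA.
Qed.

Lemma dirichlet_wellposed (phi : vboundary mu Omega -> R) :
  exists! u, dirichlet_solution phi u.
Proof.
have zero_sol (f : T -> R) : (forall x, laplacian f x = 0) ->
    (forall z, f (inB z) = 0) -> forall x, f x = 0.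
  move=> Lf fB x; apply/eqP; rewrite eq_le max_principle//=; last first.
    by move=> z; rewrite fB.
  rewrite -oppr_le0 -mulN1r -[_ * _]addr0.
  apply: (@max_principle (fun y => -1 * f y + (fun=> 0) y)) => [w|z].
    rewrite laplacianD Lf mulr0 add0r /laplacian fsbig1 ?mulr0// => y _.
    by rewrite subrr mulr0.
  by rewrite fB mulr0 addr0.
have [s s_uniq ins] : exists2 s : seq T, uniq s & forall y, y \in s.
  have [s sE] := (finite_seqP _).1 (vclosure_finite [set: T]).
  exists (undup s) => [|y]; first exact: undup_uniq.
  by have : [set: T] y by []; rewrite mem_undup sE.
pose n := size s.
have idx_lt (y : T) : (index y s < n)%N by rewrite index_mem.
pose enc (y : T) : 'I_n := Ordinal (idx_lt y).
pose dec (i : 'I_n) : T := tnth (in_tuple s) i.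
have encK y : dec (enc y) = y.
  by rewrite /dec (tnth_nth y) /= nth_index.
pose D (f : T -> R) (x : T) : R :=
  match pselect (Omega (val x)) with
  | left Ox => laplacian f (SigSub (mem_set Ox))
  | right _ => f x
  end.
have DO f (o : Omega) : D f (inO o) = laplacian f o.
  rewrite /D; case: pselect => [Ox|]; last by move/(_ (set_valP o)).
  by congr laplacian; exact: val_inj.
have DB f z : D f (inB z) = f (inB z).
  by rewrite /D; case: pselect => // Oz; have [] := set_valP z.
have DD a f g x : D (fun y => a * f y + g y) x = a * D f x + D g x.
  by rewrite /D; case: pselect => // Ox; rewrite laplacianD.
pose fn (v : 'rV[R]_n) (y : T) : R := v 0 (enc y).
pose L (v : 'rV[R]_n) : 'rV[R]_n := \row_i D (fn v) (dec i).
have Llin : linear L.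
  move=> a u v; apply/rowP => i; rewrite !mxE -DD.
  by congr D; apply/funext => y; rewrite /fn !mxE.
pose Lm := GRing.isLinear.Build R _ _ _ L Llin.
pose LL : {linear 'rV[R]_n -> 'rV[R]_n} := HB.pack L Lm.
pose A := lin1_mx LL.
have AE v : v *m A = L v by rewrite mul_rV_lin1.
have Afree : row_free A.
  apply: inj_row_free => v; rewrite AE => /rowP Lv0.
  have Dv0 y : D (fn v) y = 0.
    by have := Lv0 (enc y); rewrite !mxE encK.
  apply/rowP => i; rewrite mxE.
  have encdec : enc (dec i) = i.
    by apply/val_inj; rewrite /= /dec (tnth_nth (dec i)) /= index_uniq.
  rewrite -encdec; apply: (zero_sol (fn v)) => [w|z].
    by rewrite -DO Dv0.
  by rewrite -DB Dv0.
have Aunit : A \in unitmx by rewrite -row_free_unit.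
pose target : 'rV[R]_n := \row_i
  if pselect (Omega (val (dec i))) is right nO then
    if pselect (vboundary mu Omega (val (dec i))) is left Bi
    then phi (SigSub (mem_set Bi)) else 0
  else 0.
have Dsol x : D (fn (target *m invmx A)) x = target 0 (enc x).
  by rewrite -{2}(mulmxKV Aunit target) AE mxE encK.
set v := target *m invmx A in Dsol *.
have sol : dirichlet_solution phi (fn v).
  split=> [w|z].
    by rewrite -DO Dsol mxE encK; case: pselect => // /(_ (set_valP w)).
  rewrite -DB Dsol mxE encK; case: pselect => [Oz|_].
    by have [/(_ Oz)] := set_valP z.
  case: pselect => [Bz|/(_ (set_valP z))//].
  by congr phi; exact: val_inj.
case: sol (sol) => Lv Bv sol; exists (fn v); split=> // u [Lu Bu].
apply/funext => x; apply/esym/eqP; rewrite -subr_eq0; apply/eqP.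
rewrite addrC -mulN1r; apply: (zero_sol (fun y => -1 * fn v y + u y)) => [w|z].
  by rewrite laplacianD Lv Lu mulr0 addr0.
by rewrite Bv Bu mulN1r addNr.
Qed.
End Wellposedness.

(* Main.v *)
Require Import Defs.
From mathcomp Require Import all_boot all_order all_algebra.
From mathcomp Require Import all_classical all_reals all_analysis.
From mathcomp Require Import finmap lra.
Import Order.TTheory GRing.Theory Num.Theory.
Local Open Scope classical_set_scope.
Local Open Scope ring_scope.

(** For the l^oo bound, the maximum principle gives |u| <= 1, and the normal
    derivative is an average of differences u(z) - u(x). For the l^2 bound,
    Cauchy-Schwarz at each boundary vertex bounds ||Lambda phi||^2 by the part
    of the Dirichlet energy of u carried by the boundary edges. By Green's
    formula the whole energy is <Lambda phi, phi>, which is at most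
    (||Lambda phi||^2 + ||phi||^2) / 2. *)

(** Non-neighbours have weight zero, so sums over neighbours become sums over one fixed list, where
    sums can be exchanged. *)
Lemma fsbig_setT (R : eqType) (idx : R) (op : Monoid.com_law idx)
    (T : choiceType) (P : set T) (F : T -> R) :
  finite_set [set: T] -> (forall x, ~ P x -> F x = idx) ->
  \big[op/idx]_(x \in P) F x = \big[op/idx]_(x <- fset_set [set: T]) F x.
Proof.
move=> Tfin F0; rewrite -fsbig_finite //; apply: fsbig_widen => // x [_].
exact: F0.
Qed.

(** * Inequalities for weighted finite sums *)

Section FiniteSums.
Set Implicit Arguments.
Context {R : realFieldType} {I J : Type} (r : seq I) (s : seq J).

(** Summation by parts: [(g x - g y) ^+ 2] is [g x * (g x - g y)] plus [g y * (g y - g x)], and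
    symmetry of [c] makes both halves sum to the same value. *)
Lemma dirichlet_form_sym (c : J -> J -> R) (g : J -> R) :
  (forall x y, c x y = c y x) ->
  \sum_(x <- s) \sum_(y <- s) c x y * (g x - g y) ^+ 2 =
  2 * \sum_(x <- s) g x * \sum_(y <- s) c x y * (g x - g y).
Proof.
move=> c_sym; rewrite mulr_natl mulr2n.
under [X in _ = X + _]eq_bigr do rewrite mulr_sumr.
under [X in _ = _ + X]eq_bigr do rewrite mulr_sumr.
rewrite [X in _ = _ + X]exchange_big -big_split /=; apply: eq_bigr => x _.
rewrite -big_split /=; apply: eq_bigr => y _; rewrite (c_sym y x); lra.
Qed.

(* Green's formula with the interior edges, of nonnegative energy, dropped. *)
Lemma boundary_energy_le (a : I -> J -> R) (c : J -> J -> R)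
    (f : I -> R) (g : J -> R) :
  (forall x y, 0 <= c x y) -> (forall x y, c x y = c y x) ->
  (forall x, \sum_(y <- s) c x y * (g y - g x) +
             \sum_(z <- r) a z x * (f z - g x) = 0) ->
  \sum_(z <- r) \sum_(x <- s) a z x * (f z - g x) ^+ 2 <=
  \sum_(z <- r) f z * \sum_(x <- s) a z x * (f z - g x).
Proof.
move=> c_ge0 c_sym harm.
have form_ge0 : 0 <= \sum_(x <- s) g x * \sum_(y <- s) c x y * (g x - g y).
  rewrite -(@pmulr_rge0 _ 2) // -dirichlet_form_sym //.
  by do 2![apply: sumr_ge0 => ? _]; rewrite mulr_ge0 ?sqr_ge0.
(* In fact equality holds: since [f z - (f z - g x) = g x], the gap is the sum of
   [g x * (a z x * (f z - g x))], and harmonicity at [x] trades the boundary flux for the interior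
   one. *)
rewrite -subr_ge0; apply: le_trans form_ge0 _; rewrite le_eqVlt.
apply/orP; left; apply/eqP.
transitivity (\sum_(x <- s) \sum_(z <- r) g x * (a z x * (f z - g x))).
  apply: eq_bigr => x _; rewrite -mulr_sumr; congr (_ * _).
  move/eqP: (harm x); rewrite addrC addr_eq0 => /eqP ->.
  by rewrite -sumrN; apply: eq_bigr => y _; rewrite -mulrN opprB.
rewrite exchange_big -sumrB /=; apply: eq_bigr => z _.
rewrite mulr_sumr -sumrB; apply: eq_bigr => x _; lra.
Qed.

(** The variance of [d] about its weighted mean [t] is nonnegative; expanding it gives the bound. *)
Lemma weighted_mean_sqr_le (w d : J -> R) :
  (forall x, 0 <= w x) ->
  (\sum_(x <- s) w x) * ((\sum_(x <- s) w x)^-1 * \sum_(x <- s) w x * d x) ^+ 2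
  <= \sum_(x <- s) w x * d x ^+ 2.
Proof.
move=> w_ge0; set m := \sum_(x <- s) w x; set S := \sum_(x <- s) w x * d x.
have [m0|m_neq0] := eqVneq m 0.
  by rewrite m0 mul0r; apply: sumr_ge0 => x _; rewrite mulr_ge0 ?sqr_ge0.
set t := m^-1 * S.
have St : S = m * t by rewrite /t mulrA mulfV ?mul1r.
have : 0 <= \sum_(x <- s) w x * (d x - t) ^+ 2.
  by apply: sumr_ge0 => x _; rewrite mulr_ge0 ?sqr_ge0.
have -> : \sum_(x <- s) w x * (d x - t) ^+ 2 =
    \sum_(x <- s) w x * d x ^+ 2 - 2 * t * S + t ^+ 2 * m.
  rewrite /S /m !mulr_sumr -sumrB -big_split /=.
  by apply: eq_bigr => x _; lra.
rewrite St; lra.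
Qed.

Lemma weighted_mean_norm_le (w d : J -> R) (k : R) :
  0 <= k -> (forall x, 0 <= w x) -> (forall x, `|d x| <= k) ->
  `|(\sum_(x <- s) w x)^-1 * \sum_(x <- s) w x * d x| <= k.
Proof.
move=> k_ge0 w_ge0 dk; set m := \sum_(x <- s) w x.
have m_ge0 : 0 <= m by exact: sumr_ge0.
(* With zero total weight the mean is [0], as [0^-1 = 0]; [k_ge0] covers this case. *)
have [m0|m_neq0] := eqVneq m 0; first by rewrite m0 invr0 mul0r normr0.
rewrite normrM ger0_norm ?invr_ge0 // ler_pdivrMl ?lt0r ?m_neq0 //.
rewrite mulr_suml; apply: le_trans (ler_norm_sum _ _ _) _.
by apply: ler_sum => x _; rewrite normrM ger0_norm // ler_wpM2l.
Qed.

End FiniteSums.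

(** * From sums over neighbours to sums over the interior and the boundary *)

Section DirichletToNeumannBounds.
Set Implicit Arguments.
Context {R : realType} {V : countType} {mu : V -> V -> R} {Omega : set V}.
Hypothesis mu_ge0 : forall x y, 0 <= mu x y.
Hypothesis mu_sym : forall x y, mu x y = mu y x.
Hypothesis Omega_fin : finite_set Omega.
Hypothesis boundary_fin : finite_set (vboundary mu Omega).
Hypothesis boundary_neq0 : vboundary mu Omega !=set0.
Hypothesis tilde_connected : connected_tilde mu Omega.

Local Notation T := (vclosure mu Omega).
Local Notation dO := (vboundary mu Omega).
Local Notation inO := (@from_interior R V mu Omega).
Local Notation inB := (@from_boundary R V mu Omega).
Local Notation sO := (fset_set [set: Omega]).
Local Notation sB := (fset_set [set: dO]).

Lemma not_adj (x y : V) : ~ adj mu x y -> mu x y = 0.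
Proof. by move/negP; rewrite /adj lt0r mu_ge0 andbT negbK => /eqP. Qed.

Lemma setT_interior_finite : finite_set [set: Omega].
Proof. by rewrite (eq_finite_set (card_setT Omega)). Qed.

Lemma setT_boundary_finite : finite_set [set: dO].
Proof. by rewrite (eq_finite_set (card_setT dO)). Qed.

(** The measure of [z] is the total weight of its edges into [Omega], which makes the normal
    derivative a genuine weighted mean. *)
Lemma vmeasure_boundary (z : dO) :
  vmeasure (inB z) = \sum_(x <- sO) mu (val z) (val x).
Proof.
have [Oz _] := set_valP z.
rewrite /vmeasure ifF; last by apply/negbTE; rewrite notin_setE.
rewrite -(@fsbig_setT _ _ _ _ [set x : Omega | adj mu (val z) (val x)]).
- apply: reindex_fsbig; split=> [x /= zx|x y _ _|y [Oy zy]].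
  + by split=> //; exact: set_valP.
  + exact: val_inj.
  + by exists (SigSub (mem_set Oy)).
- exact: setT_interior_finite.
- by move=> x; exact: not_adj.
Qed.

Lemma normal_derivativeE (f : T -> R) (z : dO) :
  normal_derivative f z = (\sum_(x <- sO) mu (val z) (val x))^-1 *
    \sum_(x <- sO) mu (val z) (val x) * (f (inB z) - f (inO x)).
Proof.
rewrite /normal_derivative vmeasure_boundary fsbig_setT //.
  exact: setT_interior_finite.
by move=> x; rewrite /= adjC // => /not_adj ->; rewrite mul0r.
Qed.

Lemma vmeasure_boundary_gt0 (z : dO) : 0 < vmeasure (inB z).
Proof.
have [_ [y Oy zy]] := set_valP z.
pose x : Omega := SigSub (mem_set Oy).
rewrite vmeasure_boundary -fsbig_finite; last exact: setT_interior_finite.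
rewrite (fsbigD1 x) //=; last exact: setT_interior_finite.
by rewrite ltr_wpDr // fsumr_ge0.
Qed.

Lemma sum_vclosure (F : T -> R) :
  \sum_(y \in [set: T]) F y =
  \sum_(x <- sO) F (inO x) + \sum_(z <- sB) F (inB z).
Proof.
have -> : [set: T] = inO @` setT `|` inB @` setT.
  apply/seteqP; split=> // y _.
  by have [[x <-]|[z <-]] := vclosure_cases y; [left|right]; exists x || exists z.
rewrite fsbigU0; try exact: vclosure_finite; last first.
  move=> y [[x _ <-] [z _ /(congr1 val) zx]].
  have {}zx : val z = val x by exact: zx.
  have [Oz _] := set_valP z; apply: Oz.
  by rewrite -[X in Omega X]/(val z) zx; exact: set_valP.
rewrite !fsbig_image; first last.
- by move=> x y _ _ /(congr1 val) /= xy; exact: val_inj.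
- by move=> x y _ _ /(congr1 val) /= xy; exact: val_inj.
congr (_ + _); rewrite fsbig_finite //.
  exact: setT_interior_finite.
exact: setT_boundary_finite.
Qed.

(** Harmonicity in the shape that [boundary_energy_le] expects: no normalisation, interior and
    boundary edges apart. *)
Lemma laplacian_eq0 (f : T -> R) (x : Omega) : laplacian f x = 0 ->
  \sum_(y <- sO) mu (val x) (val y) * (f (inO y) - f (inO x)) +
  \sum_(z <- sB) mu (val x) (val z) * (f (inB z) - f (inO x)) = 0.
Proof.
pose F (y : T) := mu (val x) (val y) * (f y - f (inO x)).
move=> Lf; rewrite -(sum_vclosure F).
rewrite -(@fsbig_widen _ _ _ _ [set y : T | adj mu (val x) (val y)]) //.
  (* A neighbour of [x] makes its measure positive, so the factor cancels; without one the sum is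
     empty. *)
  have [[y xy]|nadj] := pselect (exists y, adj mu (val x) y).
    move/eqP: Lf; rewrite /laplacian mulf_eq0 invr_eq0.
    by rewrite gt_eqF ?(vmeasure_interior_gt0 _ _ _ _ xy) // => /eqP.
  by apply: fsbig1 => y xy; case: nadj; exists (val y).
by move=> y [_ /not_adj xy] /=; rewrite /F xy mul0r.
Qed.

(** * Harmonic extensions and the maximum principle *)

Lemma harmonic_extensionP (phi : dO -> R) :
  dirichlet_solution phi (harmonic_extension phi).
Proof.
(* Existence of a solution rules out the default value of [xget]. *)
apply: (@xgetPex _ _ (dirichlet_solution phi)).
have [u [u_sol _]] := dirichlet_wellposed mu_ge0 mu_sym Omega_fin boundary_fin
  boundary_neq0 tilde_connected phi.
by exists u.
Qed.

(** Constants are harmonic, so [max_principle] applies to [f - k], written as a combination that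
    [laplacianD] can match. *)
Lemma harmonic_le (f : T -> R) (k : R) : (forall x, laplacian f x = 0) ->
  (forall z, f (inB z) <= k) -> forall x, f x <= k.
Proof.
move=> Lf fB x.
have L_cst y : laplacian (fun=> - k : R) y = 0 :> R.
  by rewrite /laplacian fsbig1 ?mulr0 // => w _; rewrite subrr mulr0.
have := @max_principle R V mu Omega mu_ge0 mu_sym Omega_fin boundary_fin
  boundary_neq0 tilde_connected (fun y => 1 * f y + (fun=> - k) y).
rewrite -subr_le0 -[f x]mul1r; apply=> [y|z].
  by rewrite laplacianD // Lf L_cst mulr0 addr0.
by rewrite mul1r subr_le0.
Qed.

Lemma harmonic_norm_le (f : T -> R) (k : R) : (forall x, laplacian f x = 0) ->
  (forall z, `|f (inB z)| <= k) -> forall x, `|f x| <= k.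
Proof.
move=> Lf fB x; rewrite ler_norml; apply/andP; split; last first.
  by apply: harmonic_le x => // z; exact: le_trans (ler_norm _) (fB z).
rewrite lerNl -mulN1r -[_ * _]addr0.
apply: (@harmonic_le (fun y => -1 * f y + (fun=> 0) y)) => [y|z].
  rewrite laplacianD // Lf mulr0 add0r /laplacian fsbig1 ?mulr0 // => w _.
  by rewrite subrr mulr0.
by rewrite addr0 mulN1r; apply: le_trans (fB z); rewrite -normrN ler_norm.
Qed.

(** * Pointwise and quadratic bounds, then the operator norms *)

Lemma dtn_norm_le (phi : dO -> R) (k : R) :
  (forall z, `|phi z| <= k) -> forall z, `|dtn mu Omega phi z| <= 2 * k.
Proof.
move=> phik z; have [Lu uB] := harmonic_extensionP phi.
have uk : forall x, `|harmonic_extension phi x| <= k.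
  by apply: harmonic_norm_le => // w; rewrite uB.
have k_ge0 : 0 <= k := le_trans (normr_ge0 _) (phik z).
rewrite /dtn normal_derivativeE; apply: weighted_mean_norm_le => // [|x].
  by rewrite mulr_ge0.
(* The factor [2] is the triangle inequality: the values at [z] and at [x] each contribute at most
   [k]. *)
by apply: le_trans (ler_normB _ _) _; rewrite mulr_natl mulr2n lerD.
Qed.

Lemma dtn_sqr_le (phi : dO -> R) :
  \sum_(z <- sB) dtn mu Omega phi z ^+ 2 * vmeasure (inB z) <=
  \sum_(z <- sB) phi z ^+ 2 * vmeasure (inB z).
Proof.
have [Lu uB] := harmonic_extensionP phi; set u := harmonic_extension phi in Lu uB.
pose d z x := u (inB z) - u (inO x).
have energy : \sum_(z <- sB) \sum_(x <- sO) mu (val z) (val x) * d z x ^+ 2 <=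
    \sum_(z <- sB) phi z * \sum_(x <- sO) mu (val z) (val x) * d z x.
  under [leRHS]eq_bigr do rewrite -uB.
  (* Here [f] and [g] are the restrictions of [u] to the boundary and to the interior. *)
  apply: (@boundary_energy_le _ _ _ _ _ _ (fun x y => mu (val x) (val y))) => //.
  move=> x; rewrite -[RHS](laplacian_eq0 _ _ (Lu x)); congr (_ + _).
  by apply: eq_bigr => z _; rewrite mu_sym.
have cs : \sum_(z <- sB) dtn mu Omega phi z ^+ 2 * vmeasure (inB z) <=
    \sum_(z <- sB) \sum_(x <- sO) mu (val z) (val x) * d z x ^+ 2.
  apply: ler_sum => z _.
  rewrite mulrC vmeasure_boundary /dtn normal_derivativeE.
  exact: weighted_mean_sqr_le.
have amgm : 2 * \sum_(z <- sB) phi z * \sum_(x <- sO) mu (val z) (val x) * d z x <=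
    \sum_(z <- sB) dtn mu Omega phi z ^+ 2 * vmeasure (inB z) +
    \sum_(z <- sB) phi z ^+ 2 * vmeasure (inB z).
  rewrite mulr_sumr -big_split /=; apply: ler_sum => z _.
  (* Undoing the normalisation, the flux through [z] is its measure times the normal derivative; the
     claim is then the expanded square of the difference of [dtn mu Omega phi z] and [phi z]. *)
  have -> : \sum_(x <- sO) mu (val z) (val x) * d z x =
      vmeasure (inB z) * dtn mu Omega phi z.
    rewrite /dtn normal_derivativeE -vmeasure_boundary mulrA mulfV ?mul1r //.
    by rewrite gt_eqF // vmeasure_boundary_gt0.
  have := mulr_ge0 (ltW (vmeasure_boundary_gt0 z))
    (sqr_ge0 (dtn mu Omega phi z - phi z)); lra.
(* Writing A and B for the left and right sides, [cs] and [energy] bound A by the pairing and [amgm]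
   bounds twice the pairing by A + B, so 2A <= A + B. *)
lra.
Qed.

Lemma lp_norm2E (phi : dO -> R) :
  lp_norm 2%:E phi =
  Num.sqrt (\sum_(z <- sB) phi z ^+ 2 * vmeasure (inB z)).
Proof.
rewrite /lp_norm fsbig_finite; last exact: setT_boundary_finite.
under eq_bigr do rewrite (@powR_mulrn _ _ 2) // real_normK ?num_real //.
rewrite powR12_sqrt // sumr_ge0 // => z _.
by rewrite mulr_ge0 ?sqr_ge0 // ltW ?vmeasure_boundary_gt0.
Qed.

Lemma operator_norm2_dtn_le1 : (operator_norm 2%:E (dtn mu Omega) <= 1)%E.
Proof.
apply: ge_ereal_sup => _ [phi phi1 <-]; rewrite lee_fin.
by rewrite -[leRHS]phi1 !lp_norm2E ler_wsqrtr // dtn_sqr_le.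
Qed.

Lemma operator_normoo_dtn_le2 : (operator_norm +oo (dtn mu Omega) <= 2%:E)%E.
Proof.
apply: ge_ereal_sup => _ [phi phi1 <-]; rewrite lee_fin.
have phi_le1 z : `|phi z| <= 1.
  rewrite -phi1; apply: sup_upper_bound; last by exists z.
  (* The supremum of a set without [has_sup] is 0, not 1. *)
  apply: contrapT => /sup_out sup0.
  by move: phi1; rewrite /= sup0 => /eqP; rewrite eq_sym oner_eq0.
(* [ge_sup] asks for a nonempty set of values, which a boundary vertex supplies. *)
have [b Bb] := boundary_neq0; pose z : dO := SigSub (mem_set Bb).
apply: ge_sup => [|_ [w _ <-]]; first by exists `|dtn mu Omega phi z|, z.
by rewrite -[2]mulr1 dtn_norm_le.
Qed.

End DirichletToNeumannBounds.

Theorem proposition3p1 (R : realType) (V : countType) (mu : V -> V -> R)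
    (mu_ge0 : forall x y, 0 <= mu x y)
    (mu_sym : forall x y, mu x y = mu y x)
    (Omega : set V)
    (Omega_fin : finite_set Omega) (Omega_neq0 : Omega !=set0)
    (boundary_fin : finite_set (vboundary mu Omega))
    (boundary_neq0 : vboundary mu Omega !=set0)
    (tilde_connected : connected_tilde mu Omega) :
  (operator_norm 2%:E (dtn mu Omega) <= 1)%E /\
  (operator_norm +oo (dtn mu Omega) <= 2%:E)%E.
Proof.
split; first exact: operator_norm2_dtn_le1.
exact: operator_normoo_dtn_le2.
Qed.
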